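(* In the neighborhood priority model, under the RevealMore policy, for any realized utilities and drawn lottery $\pi$, there exists a unique Bayesian Nash equilibrium (BNE), characterized by a vector of school cutoffs $(x^\pi_1,x^\pi_2,\dots,x^\pi_m)\in\{1,2,\dots,n\}^m$, with $x^\pi_1<x^\pi_2<\cdots<x^\pi_m$, such that, for every student $i$: - If $\pi(i)\in[1,x^\pi_1]$, or $i\in I_{s_1}$, then $i$ is admitted to $s_1$ by ranking it highest in his rank-order list. - If, for some $2\le k\le m$, $\pi(i)\in(x^\pi_{k-1},x^\pi_k]$, or $\pi(i)>x^\pi_k$ but $i\in I_{s_k}$, then $i$ is admitted to $s_k$ by ranking it essentially highest in his rank-order list.
   Context: Neighborhood priority model. There are $n$ students $I=\{i_1,\dots,i_n\}$ and $m$ schools $S=\{s_1,\dots,s_m\}$. Each school $s$ has capacity $q_s\in\mathbb N$, and $\sum_{s\in S}q_s=n$. Each student $i$ has a utility vector $\mathbf v^i=(v^i_1,\dots,v^i_m)$, where $v^i_k\in[0,1]$ is his utility of attending $s_k$. Each $\mathbf v^i$ is drawn independently from a finite set $\mathcal V$ of vectors $(v_k)_{k=1}^m\in[0,1]^m$ with $v_1>v_2>\cdots>v_m$, with probability $f(\mathbf v^i)\in(0,1)$; so all students have the ordinal preference $s_1\succ s_2\succ\cdots\succ s_m$. Students know their own utilities but not the others', except for the distribution $f$; the number of students and the capacities are common knowledge. For each school $s$, a subset $I_s\subset I$ of students lives in its neighborhood, with $|I_s|=n_s\in(0,q_s)$. Each student lives in the neighborhood of at most one school, and $n-\sum_{s\in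 S}n_s$ students live in no neighborhood. Each school $s$ ranks the students in $I_s$ above the others; students within $I_s$, and students within $I\setminus I_s$, are in ties. Ties are broken by a single lottery, a one-to-one mapping $\pi:I\to\{1,\dots,n\}$ drawn uniformly at random; smaller numbers are ranked higher. A matching assigns each student to a school or leaves him unmatched, respecting capacities. Each student submits a rank-order list (ROL) of at most $\ell$ schools, where $\ell<m$. The mechanism is $\mathrm{DA}^\ell$, student-proposing deferred acceptance with these constrained lists and the tie-broken priorities: in each step every unassigned student applies to the best school on his ROL that has not rejected him, and each school tentatively admits, up to capacity, the highest-ranked applicants among those tentatively admitted in the previous step and the new applicants. RevealMore policy: utilities are realized; the lottery $\pi$ is drawn; policymakers privately reveal $\pi(i)$ to each student $i$ and publicly reveal, for each school $s$ and each possible lottery number $x$, the number $n^\pi_s(x)=|\{i\in I_s:\pi(i)\le x\}|$; students then submit ROLs; the matching is found by $\mathrm{DA}^\ell$. BNE refers to the resulting game of incomplete information. A student ranks $s_k$ ''essentially highest'' if he ranks $s_k$ highest or only below some schools in $\{s_1,\dots,s_{k-1}\}$.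
   Formalization: The BNE is unique in its matching, not its ROLs (neighborhood students past their cutoff may rank s_k lower in some BNE); residents of better schools' neighborhoods are exempt from (x_{k-1},x_k]; strategies are pure, ℓ≥1, and being unmatched is worse than every school. *)

(* Defs.v *)
From HB Require Import structures.
From mathcomp Require Import all_boot all_order all_algebra all_fingroup finmap.

Set Implicit Arguments.
Unset Strict Implicit.
Unset Printing Implicit Defensive.

Import Order.TTheory GRing.Theory Num.Theory.

Local Open Scope ring_scope.

(* Students are 'I_n and schools are 'I_m.  Ordinals count from 0: the ordinal
   k stands for the school written s_(k+1) in 1-based notation, so smaller
   ordinals are better schools for everybody. *)
Record neighborhood_model (R : realFieldType) (n m : nat) := NeighborhoodModel {
  capacity : 'I_m -> nat;
  neighborhood : 'I_m -> {set 'I_n};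
  utilities : {fset {ffun 'I_m -> R}};
  utility_prob : utilities -> R;
  (* Utility of being unmatched.  A school may itself have utility 0, so it is
     not fixed to 0; it only has to be worse than attending any school. *)
  unmatched_utility : R;
  capacity_sum : (\sum_(s < m) capacity s = n)%N;
  neighborhood_card :
    forall s : 'I_m, (0 < #|neighborhood s| < capacity s)%N;
  neighborhood_disjoint :
    forall s t : 'I_m, s != t -> [disjoint neighborhood s & neighborhood t];
  utilities_range :
    forall (v : utilities) (k : 'I_m), 0 <= val v k <= 1;
  utilities_decreasing :
    forall (v : utilities) (j k : 'I_m), (j < k)%N -> val v k < val v j;
  utility_prob_range :
    forall v : utilities, 0 < utility_prob v < 1;
  utility_prob_sum : \sum_(v : utilities) utility_prob v = 1;
  unmatched_utility_lt :
    forall (v : utilities) (k : 'I_m), unmatched_utility < val v k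
}.

(* A lottery is a permutation of 'I_n; lottery numbers are in {1, ..., n}. *)
Definition lottery_number (n : nat) (pi : {perm 'I_n}) (i : 'I_n) : nat :=
  (pi i).+1.

Definition rol (m ell : nat) : Type :=
  {r : seq 'I_m | uniq r && (size r <= ell)%N}.

(* For k = 0 no school may precede k, i.e., k is ranked highest. *)
Definition essentially_highest (m ell : nat) (r : rol m ell) (k : 'I_m) : bool :=
  (k \in val r) && all (fun j : 'I_m => (j < k)%N) (take (index k (val r)) (val r)).

Section Mechanism.
Variables (R : realFieldType) (n m : nat) (M : neighborhood_model R n m).

Definition higher_priority (pi : {perm 'I_n}) (s : 'I_m) (i j : 'I_n) : bool :=
  let li := i \in neighborhood M s in
  let lj := j \in neighborhood M s in
  (li && ~~ lj) ||
  ((li == lj) && (lottery_number pi i < lottery_number pi j)%N).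

(* The state of the deferred acceptance procedure is the set of pairs
   (student, school) such that the school has rejected the student.  A student
   is then at the best school of his list that has not rejected him: he is
   either tentatively admitted there already, or applying there. *)
Definition da_target (L : 'I_n -> seq 'I_m) (rej : {set 'I_n * 'I_m})
    (i : 'I_n) : option 'I_m :=
  ohead [seq s <- L i | (i, s) \notin rej].

Definition da_step (pi : {perm 'I_n}) (L : 'I_n -> seq 'I_m)
    (rej : {set 'I_n * 'I_m}) : {set 'I_n * 'I_m} :=
  rej :|: [set p : 'I_n * 'I_m |
    (da_target L rej p.1 == Some p.2) &&
    (capacity M p.2 <=
       #|[set j | (da_target L rej j == Some p.2) &&
                  higher_priority pi p.2 j p.1]|)%N].

(* Every step before termination adds a rejection, so that n * m steps
   suffice. *)
Definition da (pi : {perm 'I_n}) (L : 'I_n -> seq 'I_m)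
    : {ffun 'I_n -> option 'I_m} :=
  [ffun i => da_target L (iter (n * m) (da_step pi L) set0) i].

End Mechanism.

Section Game.
Variables (R : realFieldType) (n m ell : nat) (M : neighborhood_model R n m).

(* A state of the world: the realized utilities and the drawn lottery. *)
Definition state : Type := ({ffun 'I_n -> utilities M} * {perm 'I_n})%type.

Definition state_prob (w : state) : R :=
  (n`!)%:R^-1 * \prod_(i < n) utility_prob (w.1 i).

(* The entry (s, x) is the number of students of the neighborhood of s with
   lottery number at most x.+1, for x.+1 in {1, ..., n}. *)
Definition public_info : Type := {ffun 'I_m * 'I_n -> nat}.

Definition revealed (pi : {perm 'I_n}) : public_info :=
  [ffun p : 'I_m * 'I_n =>
     #|[set i in neighborhood M p.1 | (lottery_number pi i <= p.2.+1)%N]|].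

(* The arguments are the student, his utility vector, his lottery number
   (shifted by 1) and the publicly revealed numbers. *)
Definition strategy_profile : Type :=
  'I_n -> utilities M -> 'I_n -> public_info -> rol m ell.

Definition submitted (sigma : strategy_profile) (w : state) (i : 'I_n) : rol m ell :=
  sigma i (w.1 i) (w.2 i) (revealed w.2).

Definition outcome (sigma : strategy_profile) (w : state)
    : {ffun 'I_n -> option 'I_m} :=
  da M w.2 (fun j => val (submitted sigma w j)).

(* The matching when student i submits r and the others follow sigma. *)
Definition deviation_outcome (sigma : strategy_profile) (w : state) (i : 'I_n)
    (r : rol m ell) : {ffun 'I_n -> option 'I_m} :=
  da M w.2 (fun j => if j == i then val r else val (submitted sigma w j)).

Definition utility_of (w : state) (i : 'I_n) (a : option 'I_m) : R :=
  if a is Some k then val (w.1 i) k else unmatched_utility M.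

Definition same_information (i : 'I_n) (w w' : state) : bool :=
  [&& w'.1 i == w.1 i, w'.2 i == w.2 i & revealed w'.2 == revealed w.2].

Definition interim_utility (sigma : strategy_profile) (i : 'I_n) (w : state)
    (r : rol m ell) : R :=
  (\sum_(w' : state | same_information i w w')
     state_prob w' * utility_of w' i (deviation_outcome sigma w' i r i))
  / (\sum_(w' : state | same_information i w w') state_prob w').

(* Every state has positive probability, so optimality is required at all
   information sets. *)
Definition bayes_nash (sigma : strategy_profile) : Prop :=
  forall (i : 'I_n) (w : state) (r : rol m ell),
    interim_utility sigma i w r <= interim_utility sigma i w (submitted sigma w i).

End Game.

(* The cutoffs x assign school k to student i.  A student living in the
   neighborhood of s is never assigned a school worse than s, so the interval
   (x_(k-1), x_k] only concerns students living in the neighborhood of no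
   school better than k. *)
Definition cutoff_school (R : realFieldType) (n m : nat)
    (M : neighborhood_model R n m) (x : 'I_m -> nat) (pi : {perm 'I_n})
    (i : 'I_n) (k : 'I_m) : bool :=
  if val k == 0%N then
    (1 <= lottery_number pi i <= x k)%N || (i \in neighborhood M k)
  else
    [&& [forall j : 'I_m, (j.+1 == k :> nat) ==> (x j < lottery_number pi i)%N],
        (lottery_number pi i <= x k)%N
      & [forall j : 'I_m, (j < k)%N ==> (i \notin neighborhood M j)]]
    || ((x k < lottery_number pi i)%N && (i \in neighborhood M k)).

(* Main.v *)
(* Let N_k and Q_k be the union of the neighborhoods and the total capacity of
   the k best schools.  The k-th cutoff is the least x such that Q_k students live
   in N_k or have a lottery number at most x; it exceeds the previous one because
   a neighborhood never fills its school.  By counting the students of N_k outside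
   the lottery segment, it is a function of the revealed numbers alone.

   A student assigned to school k by the cutoffs, and any student preceding him
   at k, is among these Q_k students.  By induction on k, in every equilibrium the
   students assigned to better schools fill them, while a student assigned to k
   obtains at least k, in every state he considers possible, by ranking k
   essentially highest; so his equilibrium utility is exactly that of k, and such
   a deviation cannot get him anything better than k either. *)
Require Import Defs.
From HB Require Import structures.
From mathcomp Require Import all_boot all_order all_algebra all_fingroup finmap.

Set Implicit Arguments.
Unset Strict Implicit.
Unset Printing Implicit Defensive.

Import Order.TTheory GRing.Theory Num.Theory.

(** An [f]-minimal element of [A] outside [B] has all its strict predecessors in [B]; if [B] had
    fewer than [q] elements, it would belong to [B] too. *)
Lemma card_low_rank (T : finType) (f : T -> nat) (A : {set T}) (q : nat) :
  q <= #|A| -> q <= #|[set a in A | #|[set b in A | f b < f a]| < q]|.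
Proof.
set B := [set a in A | _]; move=> qA; rewrite leqNgt; apply/negP => Bq.
have /card_gt0P[a0 a0D] : 0 < #|A :\: B|.
  by rewrite cardsDS ?subn_gt0 ?(leq_trans Bq) //; apply/subsetP => a; rewrite inE => /andP[].
have [a aD amin] := arg_minnP f a0D.
have /setDP[aA /negP[]] := aD; rewrite inE aA /=.
apply: leq_ltn_trans Bq; apply/subset_leq_card/subsetP => b; rewrite inE => /andP[bA bf].
apply: contraLR bf => bB; rewrite -leqNgt; apply: amin.
exact/setDP.
Qed.

(** Without a witness below [n], [find] defaults to the length [n], where [P] holds by
    hypothesis. *)
Lemma find_iotaP (P : pred nat) (n : nat) (k := find P (iota 0 n)) :
  P n -> [/\ k <= n, P k & forall y, y < k -> ~~ P y].
Proof.
move=> Pn; have kn : k <= n by rewrite /k -{2}(size_iota 0 n) find_size.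
split=> // [|y yk]; last first.
  by have := before_find 0 yk; rewrite nth_iota ?add0n ?(leq_trans yk) // => ->.
have [nk|nk] := leqP n k; first by have <- : n = k by apply/anti_leq/andP.
have := @nth_find _ 0 P (iota 0 n).
by rewrite -/k nth_iota // has_find size_iota -/k; apply.
Qed.

(** * Deferred acceptance *)

Section DeferredAcceptance.
Variables (R : realFieldType) (n m : nat) (M : neighborhood_model R n m).
Implicit Types (pi : {perm 'I_n}) (L : 'I_n -> seq 'I_m) (rej : {set 'I_n * 'I_m}).
Implicit Types (i j : 'I_n) (s t : 'I_m).

Lemma da_targetP L rej i s :
  da_target L rej i = Some s ->
  [/\ s \in L i, (i, s) \notin rej &
      forall t, t \in take (index s (L i)) (L i) -> (i, t) \in rej].
Proof.
rewrite /da_target; elim: (L i) => //= t l IH.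
case: (boolP ((i, t) \in rej)) => /= [trej|trej [<-]].
  move=> /IH[sl srej before]; rewrite inE sl orbT; split=> // u.
  case: eqP => [//|_] /=; rewrite inE => /orP[/eqP -> //|]; exact: before.
by rewrite mem_head eqxx; split.
Qed.

Lemma da_target_cases L rej i s :
  s \in L i -> (i, s) \notin rej ->
  da_target L rej i = Some s \/
  exists2 t, da_target L rej i = Some t & t \in take (index s (L i)) (L i).
Proof.
rewrite /da_target; elim: (L i) => //= t l IH.
rewrite inE eq_sym; case: (eqVneq t s) => /= [-> _ ->|ts sl srej] /=; first by left.
case: (boolP ((i, t) \in rej)) => /= trej.
  by case: (IH sl srej) => [|[u ? ?]]; [left|right; exists u; rewrite // inE orbC; apply/orP; left].
by right; exists t; rewrite ?mem_head.
Qed.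

Lemma da_target_mono L rej rej' i s :
  rej \subset rej' -> (i, s) \notin rej' ->
  da_target L rej i = Some s -> da_target L rej' i = Some s.
Proof.
move=> /subsetP sub srej' /da_targetP[sl _ before].
case: (da_target_cases sl srej') => // -[t /da_targetP[_ trej' _] /before /sub].
by rewrite (negPf trej').
Qed.

(** Since [pi i < n], the offset [n] puts all outsiders behind all residents, so priority becomes a
    comparison of numbers. *)
Definition priority_rank pi s i : nat :=
  (i \notin neighborhood M s) * n + pi i.

Lemma higher_priorityE pi s i j :
  higher_priority M pi s i j = (priority_rank pi s i < priority_rank pi s j).
Proof.
rewrite /higher_priority /priority_rank /lottery_number ltnS.
case: (i \in _); case: (j \in _) => /=; rewrite ?mul1n ?mul0n ?add0n ?ltn_add2l //.
- by rewrite (leq_trans (ltn_ord _)) ?leq_addr.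
- by apply/esym/negbTE; rewrite -leqNgt (leq_trans (ltnW (ltn_ord _))) ?leq_addr.
Qed.

Lemma priority_rank_inj pi s : injective (priority_rank pi s).
Proof.
move=> i j; rewrite /priority_rank => eqr; apply: (@perm_inj _ pi); apply: val_inj.
move: eqr; case: (_ \notin _); case: (_ \notin _); rewrite ?mul1n ?mul0n ?add0n /=.
- exact: addnI.
- by move=> e; have := ltn_ord (pi j); rewrite -e ltnNge leq_addr.
- by move=> e; have := ltn_ord (pi i); rewrite e ltnNge leq_addr.
- by [].
Qed.

Definition rejections pi L : {set 'I_n * 'I_m} := iter (n * m) (da_step M pi L) set0.

Lemma daE pi L i : da M pi L i = da_target L (rejections pi L) i.
Proof. by rewrite ffunE. Qed.

(** Every step before stabilization adds a pair, and only [n * m] pairs exist. *)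
Lemma rejections_fix pi L : da_step M pi L (rejections pi L) = rejections pi L.
Proof.
set F := da_step M pi L; pose it k := iter k F set0.
have sub k : it k \subset it k.+1 by rewrite /it /= subsetUl.
have grow k : it k.+1 = it k \/ k < #|it k.+1|.
  elim: k => [|k [eqk|IH]].
  - case: (eqVneq (it 1) (it 0)) => [|ne]; [by left|right].
    by rewrite card_gt0.
  - by left; exact: (congr1 F eqk).
  - case: (eqVneq (it k.+2) (it k.+1)) => [|ne]; [by left|right].
    apply: leq_ltn_trans IH _; apply: proper_card.
    by rewrite properEneq eq_sym ne sub.
case: (grow (n * m)) => // big.
have := max_card (mem (it (n * m).+1)).
by rewrite card_prod !card_ord leqNgt big.
Qed.

(** In an overfull school the student of lowest priority has [capacity M s] others above him, so the
    fixed point already contains his rejection. *)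
Lemma card_da_le pi L s : #|[set i | da M pi L i == Some s]| <= capacity M s.
Proof.
set T := [set i | _]; rewrite leqNgt; apply/negP => big.
have /card_gt0P[i0 i0T] : 0 < #|T| by apply: leq_ltn_trans big.
have [i iT imax] := arg_maxnP (priority_rank pi s) i0T.
have {}iT : i \in T := iT.
have : (i, s) \in rejections pi L.
  rewrite -rejections_fix inE; apply/orP; right; rewrite inE /=.
  move: (iT); rewrite inE daE => -> /=.
  have : capacity M s <= #|T :\ i| by move: big; rewrite (cardsD1 i) iT.
  move=> /leq_trans; apply; apply/subset_leq_card/subsetP => j.
  rewrite !inE daE => /andP[ji jT]; rewrite jT higher_priorityE ltn_neqAle.
  rewrite (inj_eq (@priority_rank_inj pi s)) ji /=.
  by have jT' : j \in T; [rewrite inE daE | exact: imax].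
by move: iT; rewrite inE daE => /eqP/da_targetP[_ /negPf ->].
Qed.

(** The bound is an invariant of the steps: the seats of a school that rejected [i] stay held by
    students preceding him. *)
Lemma rejectedP pi L i s :
  (i, s) \in rejections pi L ->
  capacity M s <=
    #|[set j | (da M pi L j == Some s) && higher_priority M pi s j i]|.
Proof.
pose inv rej := forall i s, (i, s) \in rej -> capacity M s <=
  #|[set j | (da_target L rej j == Some s) && higher_priority M pi s j i]|.
suff: inv (rejections pi L).
  move=> /[apply] /leq_trans; apply; apply/subset_leq_card/subsetP => j.
  by rewrite !inE daE.
rewrite /rejections; elim: (n * m) => [|k IH]; first by move=> ? ?; rewrite inE.
rewrite [X in inv X]/=; set rej := iter _ _ _ in IH *; move=> {}i {}s irej'.
set U := [set j | (da_target L rej j == Some s) && higher_priority M pi s j i].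
have capU : capacity M s <= #|U|.
  by move: irej'; rewrite inE => /orP[/IH //|]; rewrite inE => /andP[].
(* The best members of [U] survive the step: an applicant who precedes one of them also precedes
   [i], hence lies in [U], so fewer than [capacity M s] do. *)
apply: leq_trans (card_low_rank (priority_rank pi s) capU) _.
apply/subset_leq_card/subsetP => j.
rewrite inE => /andP[jU jlow]; have := jU; rewrite [in X in X -> _]inE => /andP[/eqP jt ji].
rewrite inE ji andbT; apply/eqP.
apply: (da_target_mono _ _ jt); first exact: subsetUl.
rewrite inE negb_or; have [_ -> _] := da_targetP jt.
rewrite inE /= jt eqxx /= -ltnNge; apply: leq_ltn_trans jlow.
apply/subset_leq_card/subsetP => u; rewrite !inE => /andP[-> uj].
by move: uj ji; rewrite !higher_priorityE => uj ji; rewrite uj (ltn_trans uj ji).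
Qed.

End DeferredAcceptance.

(** * Cutoffs *)

Section Cutoffs.
Variables (R : realFieldType) (n m : nat) (M : neighborhood_model R n m).
Implicit Types (pi : {perm 'I_n}) (i : 'I_n) (j k h : 'I_m) (x : nat).

Definition nbhd_upto k : {set 'I_n} := \bigcup_(h : 'I_m | h <= k) neighborhood M h.

Definition quota_upto k : nat := \sum_(h < m | h <= k) capacity M h.

Definition served pi k x : {set 'I_n} :=
  [set i | (i \in nbhd_upto k) || (lottery_number pi i <= x)].

Definition cutoff pi k : nat :=
  find (fun x => quota_upto k <= #|served pi k x|) (iota 0 n).

Definition served_upto pi k : {set 'I_n} := served pi k (cutoff pi k).

Lemma card_nbhd_lt (p : pred 'I_m) k :
  p k -> #|\bigcup_(h | p h) neighborhood M h| < \sum_(h | p h) capacity M h.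
Proof.
move=> pk; apply: (@leq_ltn_trans (\sum_(h | p h) #|neighborhood M h|)).
  elim/big_rec2: _ => [|h A c _ IH]; first by rewrite cards0.
  by apply: leq_trans (leq_card_setU _ _) _; rewrite leq_add2l.
rewrite [ltnLHS](bigD1 k) //= [ltnRHS](bigD1 k) //= -addSn leq_add //.
  by case/andP: (neighborhood_card M k).
by apply: leq_sum => h _; apply: ltnW; case/andP: (neighborhood_card M h).
Qed.

Lemma lottery_number_le pi i : lottery_number pi i <= n.
Proof. exact: ltn_ord. Qed.

Lemma served_last pi k : served pi k n = setT.
Proof. by apply/setP => i; rewrite !inE lottery_number_le orbT. Qed.

Lemma quota_upto_le k : quota_upto k <= n.
Proof.
rewrite -[leqRHS](capacity_sum M) /quota_upto.
by rewrite [leqRHS](bigID (fun h : 'I_m => h <= k)) leq_addr.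
Qed.

(** At most one student holds the number [x.+1]. Thanks to these unit steps, the least [x] reaching
    the quota meets it exactly. *)
Lemma card_served_succ pi k x : #|served pi k x.+1| <= #|served pi k x|.+1.
Proof.
pose C : {set 'I_n} := [set i | lottery_number pi i == x.+1].
have C1 : #|C| <= 1.
  apply/card_le1_eqP => i j; rewrite !inE => /eqP ix /eqP jx.
  by apply: (@perm_inj _ pi); apply: val_inj; have := etrans ix (esym jx); case.
rewrite -[leqRHS]addn1; apply: (@leq_trans #|served pi k x :|: C|).
  apply/subset_leq_card/subsetP => i.
  by rewrite !inE (leq_eqVlt _ x.+1) !ltnS -orbA (orbC (_ <= x)).
by apply: leq_trans (leq_card_setU _ _) _; rewrite leq_add2l.
Qed.

Lemma served0 pi k : served pi k 0 = nbhd_upto k.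
Proof. by apply/setP => i; rewrite !inE orbF. Qed.

Lemma cutoffP pi k : 0 < cutoff pi k <= n /\ #|served_upto pi k| = quota_upto k.
Proof.
have [] := @find_iotaP (fun x => quota_upto k <= #|served pi k x|) n.
  by rewrite served_last cardsT card_ord quota_upto_le.
rewrite -/(cutoff pi k) /served_upto => -> big small; rewrite andbT.
(* At 0 only residents are served, too few for the quota; so the cutoff has a predecessor, which
   misses the quota. *)
case: (cutoff pi k) big small => [|x] big small.
  by move: big; rewrite served0 leqNgt (@card_nbhd_lt (fun h => h <= k) k).
split=> //; apply/anti_leq/andP; split => //.
by apply: leq_trans (card_served_succ _ _ _) _; rewrite ltnNge small.
Qed.

(** Otherwise everyone served up to [k] is served up to [j] or lives near a school after [j] and up
    to [k], and these residents are too few for the added seats. *)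
Lemma cutoff_lt pi j k : j < k -> cutoff pi j < cutoff pi k.
Proof.
move=> jk; rewrite ltnNge; apply/negP => kj.
have [_ cj] := cutoffP pi j; have [_ ck] := cutoffP pi k.
pose p h := j < h <= k.
have : quota_upto k <= #|served_upto pi j :|: \bigcup_(h | p h) neighborhood M h|.
  rewrite -ck; apply/subset_leq_card/subsetP => i; rewrite !inE => /orP[|ix].
    move=> /bigcupP[h hk ih]; have [hj|jh] := leqP h j.
      by rewrite (_ : i \in nbhd_upto j) //; apply/bigcupP; exists h.
    by apply/orP; right; apply/bigcupP; exists h => //; rewrite /p jh.
  by rewrite (leq_trans ix kj) orbT.
apply/negP; rewrite -ltnNge; apply: leq_ltn_trans (leq_card_setU _ _) _.
rewrite cj {2}/quota_upto [ltnRHS](bigID (fun h : 'I_m => h <= j)) /= -addnS leq_add //.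
  apply: eq_leq; apply: eq_bigl => h.
  by case: leqP => hj; rewrite ?andbF // (leq_trans hj (ltnW jk)).
apply: leq_trans (@card_nbhd_lt p k _) _; first by rewrite /p jk leqnn.
by apply: eq_leq; apply: eq_bigl => h; rewrite -ltnNge andbC.
Qed.

Lemma cutoff_le pi j k : j <= k -> cutoff pi j <= cutoff pi k.
Proof.
rewrite leq_eqVlt => /orP[/eqP/val_inj -> //|/(cutoff_lt pi)]; exact: ltnW.
Qed.

Lemma served_uptoP pi k i :
  reflect ((exists2 h : 'I_m, h <= k & i \in neighborhood M h) \/
           lottery_number pi i <= cutoff pi k)
          (i \in served_upto pi k).
Proof.
rewrite inE; apply: (iffP orP) => -[].
- by move=> /bigcupP[h hk ih]; left; exists h.
- by right.
- by move=> [h hk ih]; left; apply/bigcupP; exists h.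
- by right.
Qed.

Lemma served_upto_sub pi j k : j <= k -> served_upto pi j \subset served_upto pi k.
Proof.
move=> jk; apply/subsetP => i /served_uptoP[[h hj ih]|ix]; apply/served_uptoP.
  by left; exists h => //; apply: leq_trans jk.
by right; apply: leq_trans ix (cutoff_le pi jk).
Qed.

(** * The assignment defined by the cutoffs *)

Local Notation assigned pi i k := (cutoff_school M (cutoff pi) pi i k).

(** As served sets grow with the school, the case analysis of [cutoff_school] amounts to taking the
    first one that contains [i]. *)
Lemma cutoff_schoolP pi i k :
  reflect (i \in served_upto pi k /\ forall j, j < k -> i \notin served_upto pi j)
          (assigned pi i k).
Proof.
have nbk : i \in neighborhood M k -> i \in served_upto pi k.
  by move=> ik; apply/served_uptoP; left; exists k.
have disj j : i \in neighborhood M k -> i \in neighborhood M j -> j = k.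
  move=> ik ij; apply/eqP/negPn/negP => jk.
  by move: (neighborhood_disjoint M jk) => /disjointFr/(_ ij); rewrite ik.
rewrite /cutoff_school; apply: (iffP idP).
  case: eqP => [k0|/eqP k0].
    move=> served_k; split=> [|j]; last by rewrite k0.
    by case/orP: served_k => [/andP[_ ix]|/nbk //]; apply/served_uptoP; right.
  case/orP => [/and3P[/forallP prev ix /forallP notn]|/andP[xi ik]].
    split; first by apply/served_uptoP; right.
    move=> j jk; apply/served_uptoP => -[[h hj ih]|].
      by have := notn h; rewrite (leq_ltn_trans hj jk) ih.
    apply/negP; rewrite -ltnNge.
    (* The definition mentions only the cutoff just before [k]; monotonicity covers all better
       schools. *)
    have k1 : k.-1 < m by rewrite (leq_ltn_trans (leq_pred k)).
    have := prev (Ordinal k1); rewrite /= prednK ?lt0n // eqxx /=.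
    by apply: leq_ltn_trans; apply: cutoff_le; rewrite -ltnS prednK ?lt0n.
  split; first exact: nbk.
  move=> j jk; apply/served_uptoP => -[[h hj ih]|].
    by move: (leq_ltn_trans hj jk); rewrite (disj h) // ltnn.
  by apply/negP; rewrite -ltnNge (ltn_trans (cutoff_lt pi jk)).
move=> [ik notj].
have nnb h : h < k -> i \notin neighborhood M h.
  move=> hk; apply: contra (notj h hk) => ih; apply/served_uptoP.
  by left; exists h.
have [ix|xi] := leqP (lottery_number pi i) (cutoff pi k).
  case: eqP => //= _; rewrite /= orbF; apply/andP; split.
    apply/forallP => j; apply/implyP => /eqP jk.
    have := notj j; rewrite -jk leqnn => /(_ isT); rewrite ltnNge; apply: contra => ?.
    by apply/served_uptoP; right.
  by apply/forallP => j; apply/implyP; apply: nnb.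
have -> : i \in neighborhood M k; last by case: eqP; rewrite !orbT.
case/served_uptoP: ik => [[h]|]; last by rewrite leqNgt xi.
rewrite leq_eqVlt => /orP[/eqP/val_inj -> //|/nnb/negP nih /nih []].
Qed.

Lemma cutoff_school_served pi i k :
  i \in served_upto pi k -> exists2 j : 'I_m, j <= k & assigned pi i j.
Proof.
move=> ik; have [j ij jmin] := @arg_minnP _ k (fun j => i \in served_upto pi j) val ik.
exists j; first exact: jmin.
apply/cutoff_schoolP; split=> // h hj; apply/negP => /jmin.
by rewrite leqNgt hj.
Qed.

Lemma cutoff_school_inj pi i j k : assigned pi i j -> assigned pi i k -> j = k.
Proof.
move=> /cutoff_schoolP[ij nj] /cutoff_schoolP[ik nk]; apply: val_inj; apply/anti_leq/andP.
by split; rewrite leqNgt; [apply: contraL ik => /nj | apply: contraL ij => /nk].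
Qed.

(** The quota of the last school is the total capacity [n], so everybody is served there. *)
Lemma cutoff_school_exists pi i : exists k, assigned pi i k.
Proof.
have m0 : 0 < m.
  case: (posnP m) => // m0; have := ltn_ord i; rewrite -{2}(capacity_sum M) big1 // => k.
  by have := ltn_ord k; rewrite {2}m0.
have m1 : m.-1 < m by rewrite prednK.
have [|k _ ik] := @cutoff_school_served pi i (Ordinal m1); last by exists k.
suff -> : served_upto pi (Ordinal m1) = setT by rewrite inE.
apply/eqP; rewrite eqEcard subsetT cardsT card_ord (cutoffP _ _).2 /quota_upto /=.
rewrite -[leqLHS](capacity_sum M); apply: eq_leq; apply: eq_bigl => h.
by rewrite -ltnS prednK ?ltn_ord.
Qed.

(** The assigned students are the difference of two consecutive served sets, whose sizes are the
    quotas; the first school has no predecessor. *)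
Lemma card_cutoff_school pi k : #|[set i | assigned pi i k]| = capacity M k.
Proof.
have quotaE : quota_upto k = capacity M k + \sum_(h < m | h < k) capacity M h.
  rewrite /quota_upto (bigD1 k) //=; congr (_ + _); apply: eq_bigl => h.
  by rewrite ltn_neqAle andbC.
have [_ ck] := cutoffP pi k.
case: (posnP k) => [k0|k0].
  rewrite -[RHS]addn0 -[X in _ + X](_ : \sum_(h < m | h < k) capacity M h = 0).
    rewrite -quotaE -ck; congr #|pred_of_set _|; apply/setP => i; rewrite inE.
    by apply/cutoff_schoolP/idP => [[]|ik] //; split=> // j; rewrite k0.
  by rewrite big1 // => h; rewrite k0.
have k1 : k.-1 < m by rewrite (leq_ltn_trans (leq_pred k)).
set j := Ordinal k1; have jk : j < k by rewrite /= prednK.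
have [_ cj] := cutoffP pi j.
have -> : [set i | assigned pi i k] = served_upto pi k :\: served_upto pi j.
  apply/setP => i; rewrite in_setD inE; apply/cutoff_schoolP/andP => [[ik nk]|[nj ik]].
    by split=> //; apply: nk.
  split=> // h hk; apply: contra nj; apply: subsetP; apply: served_upto_sub.
  by rewrite -ltnS /= prednK.
rewrite cardsDS ?served_upto_sub ?(ltnW jk) // ck cj quotaE.
suff -> : quota_upto j = \sum_(h < m | h < k) capacity M h by rewrite addnK.
by apply: eq_bigl => h; rewrite /= -ltnS prednK.
Qed.

(** If [i'] is an outsider at [k], so is [i], who then lives near no school up to [k] and is served
    through his lottery number; that of [i'] is smaller. *)
Lemma higher_priority_served pi i i' k :
  assigned pi i k -> higher_priority M pi k i' i -> i' \in served_upto pi k.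
Proof.
move=> /cutoff_schoolP[ik nk]; rewrite /higher_priority.
have [inb|inb] := boolP (i' \in neighborhood M k).
  by move=> _; apply/served_uptoP; left; exists k.
case: (boolP (i \in neighborhood M k)) => //= nik i'i; apply/served_uptoP; right.
case/served_uptoP: ik => [[h hk ih]|ix]; last by rewrite (leq_trans (ltnW i'i)).
have := nk h; rewrite ltn_neqAle hk andbT; case: eqP => [/val_inj hE|_ /(_ isT)/negP[]].
  by rewrite hE (negPf nik) in ih.
by apply/served_uptoP; left; exists h.
Qed.

(** * Cutoffs as functions of the revealed numbers *)

Lemma card_lottery_le pi x :
  #|[set i | lottery_number pi i <= x]| = #|[set y : 'I_n | y < x]|.
Proof.
rewrite -(card_preimset [set y : 'I_n | y < x] (@perm_inj _ pi)).
by congr #|pred_of_set _|; apply/setP => i; rewrite !inE.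
Qed.

Lemma card_served pi k x :
  #|served pi k x| = #|[set y : 'I_n | y < x]| +
    \sum_(h : 'I_m | h <= k)
      (#|neighborhood M h| - #|[set i in neighborhood M h | lottery_number pi i <= x]|).
Proof.
set C : {set 'I_n} := [set i | lottery_number pi i <= x].
rewrite -(card_lottery_le pi) -/C.
have -> : served pi k x = C :|: \bigcup_(h : 'I_m | h <= k) (neighborhood M h :\: C).
  apply/setP => i; rewrite !inE orbC; case: leqP => //= xi.
  apply/bigcupP/bigcupP => -[h hk ih]; exists h => //.
    by rewrite in_setD ih andbT inE -ltnNge.
  by move: ih; rewrite inE => /andP[].
have CU0 : C :&: \bigcup_(h : 'I_m | h <= k) (neighborhood M h :\: C) = set0.
  apply/setP => i; rewrite in_setI in_set0; apply/negP => /andP[iC /bigcupP[h _]].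
  by rewrite in_setD iC.
rewrite cardsU CU0 cards0 subn0.
congr (_ + _); rewrite big_mkcond /= -sum1_card partition_disjoint_bigcup => [|h j hj].
  rewrite [RHS]big_mkcond; apply: eq_bigr => h _.
  case: ifP => _; last by rewrite big_set0.
  rewrite sum1_card cardsD; congr (_ - #|pred_of_set _|).
  by apply/setP => i; rewrite !inE.
rewrite -setI_eq0; apply/eqP/setP => i; rewrite !inE.
case: ifP => _; case: ifP => _; rewrite ?inE ?andbF //.
apply/negP => /andP[/andP[_ ih] /andP[_ ij]].
by move: (neighborhood_disjoint M hj) => /disjointFr/(_ ih); rewrite ij.
Qed.

Lemma eq_cutoff pi pi' k : revealed M pi = revealed M pi' -> cutoff pi k = cutoff pi' k.
Proof.
move=> eqr; apply: eq_in_find => x; rewrite mem_iota add0n => /andP[_ xn].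
rewrite !card_served; congr (_ <= _ + _); apply: eq_bigr => h _; congr (_ - _).
(* No entry is revealed for 0, where both counts vanish; the entry for [x.+1] has index [x]. *)
case: x xn => [|x] xn.
  by congr #|pred_of_set _|; apply/setP => i; rewrite !inE ltn0 andbF.
by have := congr1 (fun f : public_info n m => f (h, Ordinal (ltnW xn))) eqr; rewrite !ffunE.
Qed.

(** Hence a student can compute his assigned school from what is revealed to him. *)
Lemma eq_cutoff_school pi pi' i k :
  revealed M pi = revealed M pi' -> pi i = pi' i -> assigned pi i k -> assigned pi' i k.
Proof.
move=> eqr eqi.
have eqB h : (i \in served_upto pi h) = (i \in served_upto pi' h).
  by rewrite !inE (eq_cutoff h eqr) /lottery_number eqi.
move=> /cutoff_schoolP[ik nk]; apply/cutoff_schoolP; rewrite -eqB; split=> // h hk.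
by rewrite -eqB nk.
Qed.

(** * Rejections of students by their assigned schools *)

Lemma exists_better pi i k (H : {set 'I_n}) :
  assigned pi i k -> (forall i', i' \in H -> higher_priority M pi k i' i) ->
  capacity M k <= #|H| ->
  exists i' j, [/\ i' \in H, j < k & assigned pi i' j].
Proof.
move=> ik above; rewrite -(card_cutoff_school pi).
have [/existsP[i' /andP[i'H /existsP[j /andP[jk i'j]]]]|none] := boolP [exists i',
    (i' \in H) && [exists j : 'I_m, (j < k) && assigned pi i' j]].
  by exists i', j.
(* Otherwise all of [H] is assigned to [k], and so is [i], who is not in [H]: too many for the
   capacity. *)
move=> cardH; suff : #|H| < #|[set i' | assigned pi i' k]| by rewrite ltnNge cardH.
apply: proper_card; rewrite properE; apply/andP; split; last first.
  apply/subsetPn; exists i; rewrite ?inE //; apply/negP => /above.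
  by rewrite higher_priorityE ltnn.
apply/subsetP => i' i'H; rewrite inE.
have [j] := cutoff_school_served (higher_priority_served ik (above _ i'H)).
rewrite leq_eqVlt => /orP[/eqP/val_inj <- //|jk] i'j.
by case/existsP: none; exists i'; rewrite i'H; apply/existsP; exists j; rewrite jk.
Qed.

Lemma rejected_better pi (L : 'I_n -> seq 'I_m) i k :
  (i, k) \in rejections M pi L -> assigned pi i k ->
  exists i' j, [/\ da M pi L i' = Some k, higher_priority M pi k i' i,
                   j < k & assigned pi i' j].
Proof.
move=> /rejectedP + ik => /(exists_better ik)[] => [i'|i' [j [+ jk i'j]]].
  by rewrite inE => /andP[].
by rewrite inE => /andP[/eqP i'k i'i]; exists i', j.
Qed.

(* A rejection of [i'] by his school [j] under [L'] needs some [i2], assigned to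
   a better school [j2], to be admitted to [j].  By induction [j2] does not reject
   [i2] under [L'], so he lists [j] above [j2]; hence [j] rejects him under [L],
   where its seats would have to be filled by students of higher priority
   than [i'], which again takes a student assigned to a better school. *)
Lemma not_rejected pi (L L' : 'I_n -> seq 'I_m) i k :
  (forall i' j, j < k -> assigned pi i' j -> da M pi L i' = Some j) ->
  assigned pi i k -> (forall i', i' != i -> L' i' = L i') ->
  (i, k) \notin rejections M pi L'.
Proof.
move=> muL ik eqL.
suff noRej c : forall i' j, j <= c -> j <= k -> assigned pi i' j ->
    (i', j) \notin rejections M pi L' by apply: noRej ik; rewrite ?leqnn.
elim: c => [|c IH] i' j jc jk i'j; apply/negP => /rejected_better/(_ i'j);
  move=> [i2 [j2 [i2j i2i' j2j i2j2]]].
  by move: (leq_trans j2j jc).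
have i2k : j2 < k := leq_trans j2j jk.
have i2i : i2 != i.
  apply: contraTneq i2j2 => ->; apply/negP => /(cutoff_school_inj ik) kj2.
  by rewrite kj2 ltnn in i2k.
have mu2 := muL _ _ i2k i2j2; have := mu2; rewrite daE => /da_targetP[j2L _ before].
have nrej := IH _ _ (leq_trans j2j jc) (ltnW i2k) i2j2.
have j2L' : j2 \in L' i2 by rewrite eqL.
have jbefore : j \in take (index j2 (L i2)) (L i2).
  rewrite -(eqL _ i2i); have := da_target_cases j2L' nrej; rewrite -daE i2j.
  by case=> [[jE]|[t [<-]] //]; rewrite jE ltnn in j2j.
have /rejectedP cap := before _ jbefore.
have [i3|i3 [j3 [+ j3j i3j3]]] := exists_better i'j _ cap.
  rewrite inE => /andP[_]; move: i2i'; rewrite !higher_priorityE => ? h.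
  exact: ltn_trans h _.
rewrite inE (muL _ _ (leq_trans j3j jk) i3j3) => /andP[/eqP[jE] _].
by rewrite jE ltnn in j3j.
Qed.

Lemma da_filled pi (L : 'I_n -> seq 'I_m) k :
  (forall i, assigned pi i k -> da M pi L i = Some k) ->
  forall i, da M pi L i = Some k -> assigned pi i k.
Proof.
move=> muL i muLi.
have : i \in [set i | da M pi L i == Some k] by rewrite inE muLi.
suff /eqP <- : [set i | assigned pi i k] == [set i | da M pi L i == Some k] by rewrite inE.
rewrite eqEcard card_cutoff_school card_da_le andbT.
by apply/subsetP => j; rewrite !inE => /muL/eqP.
Qed.

Lemma essentially_highest_da pi (L : 'I_n -> seq 'I_m) i k (ell : nat) (r : rol m ell) :
  essentially_highest r k -> L i = val r -> (i, k) \notin rejections M pi L ->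
  exists2 j : 'I_m, j <= k & da M pi L i = Some j.
Proof.
move=> /andP[kr /allP better] Li; rewrite -Li in kr better => nrej.
have [ik|[j ij /better jk]] := da_target_cases kr nrej; first by exists k; rewrite ?daE.
by exists j; rewrite ?daE // ltnW.
Qed.

(** A rejection would require a student assigned to a better school to be at [j], which he does not
    list. The list of [i] is arbitrary, so that any deviation is covered. *)
Lemma singleton_not_rejected pi (L : 'I_n -> seq 'I_m) i k :
  assigned pi i k ->
  (forall i' j, i' != i -> assigned pi i' j -> L i' = [:: j]) ->
  forall i' j, j <= k -> assigned pi i' j -> (i', j) \notin rejections M pi L.
Proof.
move=> ik Lsingle i' j jk i'j; apply/negP => /rejected_better/(_ i'j)[i2 [j2 [i2j _ j2j i2j2]]].
have i2i : i2 != i.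
  apply: contraTneq i2j2 => ->; apply/negP => /(cutoff_school_inj ik) kj2.
  by move: (leq_trans j2j jk); rewrite kj2 ltnn.
have := i2j; rewrite daE => /da_targetP[+ _ _]; rewrite (Lsingle _ _ i2i i2j2) inE.
by move=> /eqP jE; rewrite jE ltnn in j2j.
Qed.

Lemma singleton_da pi (L : 'I_n -> seq 'I_m) i k :
  L i = [:: k] -> (i, k) \notin rejections M pi L -> da M pi L i = Some k.
Proof. by move=> Li nrej; rewrite daE /da_target Li /= nrej. Qed.

End Cutoffs.

Lemma eq_da (R : realFieldType) (n m : nat) (M : neighborhood_model R n m)
    (pi : {perm 'I_n}) (L L' : 'I_n -> seq 'I_m) :
  L =1 L' -> da M pi L = da M pi L'.
Proof.
move=> eqL; have eqT rej i : da_target L rej i = da_target L' rej i.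
  by rewrite /da_target eqL.
apply/ffunP => i; rewrite !ffunE eqT; congr da_target; apply: eq_iter => rej.
congr (_ :|: _); apply/setP => p; rewrite !inE eqT; congr (_ && (_ <= _)).
by congr #|pred_of_set _|; apply/setP => j; rewrite !inE eqT.
Qed.

Lemma eq_weighted_sum (R : realFieldType) (T : finType) (P : pred T) (p F G : T -> R) :
  (forall x, P x -> 0 < p x)%R -> (forall x, P x -> F x <= G x)%R ->
  (\sum_(x | P x) p x * G x <= \sum_(x | P x) p x * F x)%R ->
  forall x, P x -> F x = G x.
Proof.
move=> p0 FG sumGF x Px; apply/eqP; rewrite eq_sym -subr_eq0.
have ge0 y : P y -> (0 <= p y * (G y - F y))%R.
  by move=> Py; rewrite mulr_ge0 ?subr_ge0 ?FG // ltW ?p0.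
have sum0 : (\sum_(y | P y) p y * (G y - F y) = 0)%R.
  apply/eqP; rewrite eq_le sumr_ge0 // andbT.
  by under eq_bigr do rewrite mulrBr; rewrite sumrB subr_le0.
have /eqP := psumr_eq0P ge0 sum0 Px.
by rewrite mulf_eq0 gt_eqF ?p0.
Qed.

(** * Equilibria *)

Section Game.
Variables (R : realFieldType) (n m ell : nat) (M : neighborhood_model R n m).
Implicit Types (sigma : strategy_profile ell M) (w : state M) (i : 'I_n) (k : 'I_m).
Implicit Types (r : rol m ell).

Local Notation assigned w i k := (cutoff_school M (cutoff M w.2) w.2 i k).

Lemma state_prob_gt0 w : (0 < state_prob w)%R.
Proof.
rewrite /state_prob mulr_gt0 ?invr_gt0 ?ltr0n ?fact_gt0 ?prodr_gt0 // => i _.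
by case/andP: (utility_prob_range (w.1 i)).
Qed.

Lemma same_information_refl i w : same_information i w w.
Proof. by rewrite /same_information !eqxx. Qed.

Lemma same_information_assigned i w w' k :
  same_information i w w' -> assigned w i k -> assigned w' i k.
Proof. by move=> /and3P[_ /eqP eqi /eqP eqr]; apply: eq_cutoff_school. Qed.

Lemma same_information_submitted sigma i w w' :
  same_information i w w' -> submitted sigma w' i = submitted sigma w i.
Proof. by move=> /and3P[/eqP eqv /eqP eqi /eqP eqr]; rewrite /submitted eqv eqi eqr. Qed.

Lemma information_prob_gt0 i w :
  (0 < \sum_(w' : state M | same_information i w w') state_prob w')%R.
Proof.
rewrite (bigD1 w) ?same_information_refl //=; apply: ltr_pwDl (state_prob_gt0 _) _.
by apply: sumr_ge0 => w' _; apply: ltW (state_prob_gt0 _).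
Qed.

Lemma deviation_outcome_submitted sigma w i :
  deviation_outcome sigma w i (submitted sigma w i) = outcome sigma w.
Proof. by apply: eq_da => j /=; case: eqP => [->|]. Qed.

Lemma interim_utility_submitted sigma i w :
  interim_utility sigma i w (submitted sigma w i) =
  ((\sum_(w' : state M | same_information i w w')
      state_prob w' * utility_of w' i (outcome sigma w' i))
   / \sum_(w' : state M | same_information i w w') state_prob w')%R.
Proof.
congr (_ / _)%R; apply: eq_bigr => w' ww'.
by rewrite -(same_information_submitted sigma ww') deviation_outcome_submitted.
Qed.

(** Optimality bounds the weighted average of the gains from [r]; these are nonnegative with
    positive weights, so each of them vanishes. *)
Lemma bayes_nash_eq_utility sigma i w r :
  bayes_nash sigma ->
  (forall w', same_information i w w' ->
     utility_of w' i (outcome sigma w' i) <=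
     utility_of w' i (deviation_outcome sigma w' i r i))%R ->
  utility_of w i (outcome sigma w i) =
  utility_of w i (deviation_outcome sigma w i r i).
Proof.
move=> nash dom; have := nash i w r.
rewrite interim_utility_submitted ler_pM2r ?invr_gt0 ?information_prob_gt0 // => le_sum.
apply: (eq_weighted_sum (p := @state_prob R n m M) _ dom le_sum) (same_information_refl i w).
by move=> w' _; apply: state_prob_gt0.
Qed.

Lemma utility_of_le w i k (a : option 'I_m) :
  (forall j, a = Some j -> k <= j) -> (utility_of w i a <= val (w.1 i) k)%R.
Proof.
case: a => [j|_] /=; last by rewrite ltW ?unmatched_utility_lt.
move=> /(_ j erefl); rewrite leq_eqVlt => /orP[/eqP/val_inj -> //|kj].
by rewrite ltW ?utilities_decreasing.
Qed.

Lemma utility_of_inj w i (a b : option 'I_m) :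
  utility_of w i a = utility_of w i b -> a = b.
Proof.
case: a b => [j|] [k|] //= e.
- congr Some; apply: val_inj; case: (ltngtP j k) => // /(utilities_decreasing (w.1 i)).
    by rewrite e ltxx.
  by rewrite e ltxx.
- by have := unmatched_utility_lt (w.1 i) j; rewrite e ltxx.
- by have := unmatched_utility_lt (w.1 i) k; rewrite e ltxx.
Qed.

Lemma singleton_rol_proof (ell_gt0 : 0 < ell) k : uniq [:: k] && (size [:: k] <= ell).
Proof. by []. Qed.

Definition singleton_rol (ell_gt0 : 0 < ell) k : rol m ell :=
  exist _ [:: k] (singleton_rol_proof ell_gt0 k).

Definition empty_rol : rol m ell := exist _ [::] isT.

Lemma singleton_rol_highest (ell_gt0 : 0 < ell) k :
  essentially_highest (singleton_rol ell_gt0 k) k.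
Proof. by rewrite /essentially_highest /= mem_head eqxx. Qed.

Lemma bayes_nash_outcome (ell_gt0 : 0 < ell) sigma w i k :
  bayes_nash sigma -> assigned w i k ->
  outcome sigma w i = Some k /\
  forall r, essentially_highest r k -> deviation_outcome sigma w i r i = Some k.
Proof.
(* The induction ranges over all states and students, since [i] compares lists across all states he
   considers possible. *)
move=> nash; have [c kc] := ubnP (val k); elim: c => // c IH in k kc w i * => ik.
have better w' (j : 'I_m) i' : j < k -> assigned w' i' j -> outcome sigma w' i' = Some j.
  by move=> jk i'j; case: (IH j _ w' i' i'j) => //; apply: leq_trans jk _.
(* Better schools are filled by their own assigned students. *)
have out_le w' : same_information i w w' ->
    (utility_of w' i (outcome sigma w' i) <= val (w'.1 i) k)%R.
  move=> ww'; apply: utility_of_le => j out; rewrite leqNgt; apply/negP => jk.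
  have := da_filled (fun i' => @better w' j i' jk) out.
  move=> /(cutoff_school_inj (same_information_assigned ww' ik)) kj.
  by rewrite kj ltnn in jk.
have dev_ge w' r : same_information i w w' -> essentially_highest r k ->
    (val (w'.1 i) k <= utility_of w' i (deviation_outcome sigma w' i r i))%R.
  move=> ww' rk; have ik' := same_information_assigned ww' ik.
  have [||j jk ->] := @essentially_highest_da R n m M w'.2
    (fun j => if j == i then val r else val (submitted sigma w' j)) i k ell r rk.
  - by rewrite eqxx.
  - apply: (not_rejected (fun i' j => @better w' j i') ik') => i' i'i.
    by rewrite (negPf i'i).
  move: jk; rewrite leq_eqVlt => /orP[/eqP/val_inj -> //|jk] /=.
  by rewrite ltW ?utilities_decreasing.
(* Equilibrium utility is at most that of [k], deviation utility at least that; optimality forces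
   equality of all three. *)
have eq_dev r : essentially_highest r k ->
    deviation_outcome sigma w i r i = Some k /\ outcome sigma w i = Some k.
  move=> rk; have eqU : utility_of w i (outcome sigma w i) =
      utility_of w i (deviation_outcome sigma w i r i).
    apply: bayes_nash_eq_utility => // w' ww'.
    by apply: le_trans (out_le _ ww') (dev_ge _ _ ww' rk).
  have ww := same_information_refl i w.
  have out : outcome sigma w i = Some k.
    apply: (@utility_of_inj w i); apply: le_anti; rewrite out_le //= eqU.
    exact: dev_ge.
  by split=> //; rewrite -out; apply/esym/(@utility_of_inj w i).
by split=> [|r /eq_dev[]//]; case: (eq_dev _ (singleton_rol_highest ell_gt0 k)).
Qed.

(** A worse school [h] listed before [k] must have rejected [i] in favor of a full set of students
    assigned to [h]. An outsider among them would have a lottery number below the cutoff of [k] and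
    be assigned to [k] or better; residents alone cannot fill [h]. *)
Lemma bayes_nash_highest (ell_gt0 : 0 < ell) sigma w i k :
  bayes_nash sigma -> assigned w i k -> lottery_number w.2 i <= cutoff M w.2 k ->
  essentially_highest (submitted sigma w i) k.
Proof.
move=> nash ik ix.
have assigned_out i' j : outcome sigma w i' = Some j -> assigned w i' j.
  have [j' i'j'] := cutoff_school_exists M w.2 i'.
  by have [-> _ [<-]] := bayes_nash_outcome ell_gt0 nash i'j'.
have [out _] := bayes_nash_outcome ell_gt0 nash ik.
have := out; rewrite /outcome daE => /da_targetP[kL _ before].
apply/andP; split=> //; apply/allP => h hbefore; rewrite ltnNge; apply/negP => kh.
have {kh} kh : k < h.
  rewrite ltn_neqAle kh andbT; apply: contraTneq hbefore => /val_inj <-.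
  by rewrite in_take // ltnn.
have /rejectedP := before _ hbefore; rewrite leqNgt => /negP[].
have /andP[_] := neighborhood_card M h; apply: leq_ltn_trans.
apply/subset_leq_card/subsetP => i'; rewrite inE => /andP[/eqP/assigned_out i'h].
apply: contraTT => i'nh; rewrite /higher_priority (negPf i'nh) /=.
apply/negP => /andP[_ i'i]; have [|j jk i'j] := @cutoff_school_served R n m M w.2 i' k.
  by apply/served_uptoP; right; rewrite (leq_trans (ltnW i'i)).
by rewrite (cutoff_school_inj i'h i'j) ltnNge jk in kh.
Qed.

(** * An equilibrium that follows the cutoffs *)

Definition cutoff_profile (ell_gt0 : 0 < ell) : strategy_profile ell M :=
  fun i _ l info =>
    (* The true lottery is unknown to [i], but every lottery consistent with his information yields
       the same school. The empty list is the default for information that no lottery generates. *)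
    if [pick p : {perm 'I_n} * 'I_m |
          [&& p.1 i == l, revealed M p.1 == info
            & cutoff_school M (cutoff M p.1) p.1 i p.2]] is Some p
    then singleton_rol ell_gt0 p.2 else empty_rol.

Lemma submitted_cutoff_profile (ell_gt0 : 0 < ell) w i k :
  assigned w i k -> submitted (cutoff_profile ell_gt0) w i = singleton_rol ell_gt0 k.
Proof.
move=> ik; rewrite /submitted /cutoff_profile; case: pickP => [[pi j] /=|/(_ (w.2, k))].
  move=> /and3P[/eqP eqi /eqP eqr ij].
  by rewrite (cutoff_school_inj ik (eq_cutoff_school eqr eqi ij)).
by rewrite /= !eqxx ik.
Qed.

Lemma outcome_cutoff_profile (ell_gt0 : 0 < ell) w i k :
  assigned w i k -> outcome (cutoff_profile ell_gt0) w i = Some k.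
Proof.
move=> ik; apply: singleton_da; first by rewrite (submitted_cutoff_profile _ ik).
apply: (singleton_not_rejected ik) => // i' j _ i'j.
by rewrite (submitted_cutoff_profile _ i'j).
Qed.

(** Deviations fail state by state: every better school remains filled by its assigned students, who
    list nothing else. *)
Lemma bayes_nash_cutoff_profile (ell_gt0 : 0 < ell) : bayes_nash (cutoff_profile ell_gt0).
Proof.
move=> i w r; rewrite interim_utility_submitted.
rewrite ler_pM2r ?invr_gt0 ?information_prob_gt0 //; apply: ler_sum => w' _.
rewrite ler_pM2l ?state_prob_gt0 //.
have [k ik] := cutoff_school_exists M w'.2 i.
rewrite (outcome_cutoff_profile _ ik) /=; apply: utility_of_le => j dev.
rewrite leqNgt; apply/negP => jk; move: dev; rewrite /deviation_outcome.
set L := (X in da _ _ X); have Lsingle i' h : i' != i -> assigned w' i' h -> L i' = [:: h].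
  by move=> /negPf i'i i'h; rewrite /L i'i (submitted_cutoff_profile _ i'h).
have filled i' : assigned w' i' j -> da M w'.2 L i' = Some j.
  move=> i'j; apply: singleton_da.
    apply: Lsingle (i'j); apply: contraTneq i'j => ->.
    by apply/negP => /(cutoff_school_inj ik) kj; rewrite kj ltnn in jk.
  exact: singleton_not_rejected ik Lsingle _ _ (ltnW jk) i'j.
by move=> /(da_filled filled)/(cutoff_school_inj ik) kj; rewrite kj ltnn in jk.
Qed.
End Game.

Theorem proposition3 (R : realFieldType) (n m ell : nat)
    (M : neighborhood_model R n m) (ell_range : (0 < ell < m)%N) :
  exists x : {perm 'I_n} -> 'I_m -> nat,
    [/\ forall (pi : {perm 'I_n}) (k : 'I_m), (1 <= x pi k <= n)%N,
        forall (pi : {perm 'I_n}) (j k : 'I_m), (j < k)%N -> (x pi j < x pi k)%N,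
        forall (pi : {perm 'I_n}) (i : 'I_n),
          exists k : 'I_m, cutoff_school M (x pi) pi i k,
        exists sigma : strategy_profile ell M,
          bayes_nash sigma /\
          forall (w : state M) (i : 'I_n) (k : 'I_m),
            cutoff_school M (x w.2) w.2 i k ->
            essentially_highest (submitted sigma w i) k /\
            outcome sigma w i = Some k
      & forall sigma : strategy_profile ell M, bayes_nash sigma ->
          forall w : state M,
            (forall sigma' : strategy_profile ell M, bayes_nash sigma' ->
               outcome sigma' w = outcome sigma w) /\
            (forall (i : 'I_n) (k : 'I_m), cutoff_school M (x w.2) w.2 i k ->
               [/\ outcome sigma w i = Some k,
                   (lottery_number w.2 i <= x w.2 k)%N ->
                     essentially_highest (submitted sigma w i) k
                 & forall r : rol m ell, essentially_highest r k ->
                     deviation_outcome sigma w i r i = Some k])].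
Proof.
have /andP[ell_gt0 _] := ell_range.
exists (cutoff M); split.
- by move=> pi k; have [] := cutoffP M pi k.
- by move=> pi j k; apply: cutoff_lt.
- by move=> pi i; apply: cutoff_school_exists.
- exists (cutoff_profile (M := M) ell_gt0); split; first exact: bayes_nash_cutoff_profile.
  move=> w i k ik; rewrite (submitted_cutoff_profile _ ik).
  by rewrite singleton_rol_highest (outcome_cutoff_profile _ ik).
(* Any two equilibria agree because each yields the matching prescribed by the cutoffs. *)
move=> sigma nash w; split=> [sigma' nash'|i k ik].
  apply/ffunP => i; have [k ik] := cutoff_school_exists M w.2 i.
  have [-> _] := bayes_nash_outcome ell_gt0 nash' ik.
  by have [-> _] := bayes_nash_outcome ell_gt0 nash ik.
have [out dev] := bayes_nash_outcome ell_gt0 nash ik; split=> //.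
exact: bayes_nash_highest.
Qed.
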